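(* Let $f_1,\dots,f_m\in F$ be $\underline{s}$-monomial type elements which form a Gröbner basis of a submodule $U\subseteq F$. For every pair $1\le i<j\le m$ such that $\operatorname{LM}(f_i)$ and $\operatorname{LM}(f_j)$ involve the same basis element of $F$, fix $q_{ij,1},\dots,q_{ij,m}\in S$ with $$S'(f_i,f_j)=u_{ij}f_i-u_{ji}f_j=q_{ij,1}f_1+\dots+q_{ij,m}f_m,$$ such that $\operatorname{LM}(S'(f_i,f_j))\ge w\operatorname{LM}(f_l)$ for every $l$ and every monomial $w$ occurring in $q_{ij,l}$ (all $q_{ij,l}=0$ if $S'(f_i,f_j)=0$). Let $L$ be a free $S$-module with basis $g_1,\dots,g_m$ and put $$r_{ij}=u_{ij}g_i-u_{ji}g_j-q_{ij,1}g_1-\dots-q_{ij,m}g_m .$$ Then the elements $r_{ij}$ (over all such pairs $i<j$) generate the $S$-module $\operatorname{Syz}(f_1,\dots,f_m)=\{\sum_i h_ig_i\in L:\ \sum_i h_if_i=0\}$.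
   Context: $R$ is a commutative ring with unit, $S=R[x_1,\dots,x_n]$, and $F=\bigoplus_{i=1}^r S$ is the free $S$-module with standard basis $e_1,\dots,e_r$. A monomial of $F$ is an element $ue_i$ with $u$ a monomial of $S$. Fix a monomial order $>$ on $F$: a total order on the monomials of $F$ such that $wm>m$ for every monomial $m$ of $F$ and every monomial $w\neq1$ of $S$, and such that $m>m'$ implies $wm>wm'$. For $0\ne f\in F$ whose largest monomial is $ue_i$, with coefficient $a\in R\setminus\{0\}$, put $\operatorname{LT}(f)=aue_i$, $\operatorname{LM}(f)=ue_i$, $\operatorname{lc}(f)=a$, $\operatorname{lm}(f)=u$; put $\operatorname{LT}(0)=0$. For a submodule $U\subseteq F$, $\operatorname{LT}(U)$ is the $S$-submodule generated by all $\operatorname{LT}(f)$, $f\in U$; a finite set $\{f_1,\dots,f_m\}\subseteq U$ is a Gröbner basis of $U$ if $\langle \operatorname{LT}(f_1),\dots,\operatorname{LT}(f_m)\rangle=\operatorname{LT}(U)$. Fix a permutable weak regular sequence $\underline{s}=s_1,\dots,s_k$ in $R$, none of whose members is a unit: after any permutation, each $s_i$ is a nonzerodivisor on $R/\langle s_1,\dots,s_{i-1}\rangle$. An $\underline{s}$-monomial is an element $s_1^{\alpha_1}\cdots s_k^{\alpha_k}$ with $\alpha_i\in\mathbb{Z}_{\ge0}$ (such an expression is unique), and an $\underline{s}$-term is a unit of $R$ times an $\underline{s}$-monomial. The $\operatorname{lcm}$ of two $\underline{s}$-monomials is the $\underline{s}$-monomial whose exponents are the maxima of the exponents. An element $f\in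 F$ is $\underline{s}$-monomial type if $\operatorname{lc}(f)$ is an $\underline{s}$-term. For $\underline{s}$-monomial type elements $f_1,\dots,f_m$ write $\operatorname{lc}(f_i)=c_ib_i$ with $c_i$ a unit and $b_i$ an $\underline{s}$-monomial, and $u_i=\operatorname{lm}(f_i)$. If the leading monomials of $f_i,f_j$ involve the same basis element, put $$u_{ij}=c_i^{-1}\,\frac{\operatorname{lcm}(b_i,b_j)}{b_i}\cdot\frac{\operatorname{lcm}(u_i,u_j)}{u_i},\qquad S'(f_i,f_j)=u_{ij}f_i-u_{ji}f_j ;$$ otherwise $S'(f_i,f_j)$ is not defined. *)

(* Defs.v *)
From HB Require Import structures.
From mathcomp Require Import all_boot all_order all_fingroup all_algebra.
From mathcomp.multinomials Require Import mpoly.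

Set Implicit Arguments.
Unset Strict Implicit.
Unset Printing Implicit Defensive.

Import GRing.Theory.
Local Open Scope ring_scope.

Section Modules.
Variables (A : comNzRingType) (V : lmodType A).

Definition is_submodule (U : V -> Prop) : Prop :=
  U 0 /\ forall (a : A) (v w : V), U v -> U w -> U (a *: v + w).

Definition gen (G : V -> Prop) (v : V) : Prop :=
  exists (N : nat) (a : 'I_N -> A) (g : 'I_N -> V),
    (forall j, G (g j)) /\ v = \sum_j a j *: g j.

Definition is_basis (m : nat) (g : 'I_m -> V) : Prop :=
  forall v : V, exists! h : {ffun 'I_m -> A}, v = \sum_i h i *: g i.

End Modules.

Section RegularSequences.
Variables (R : comUnitRingType) (k : nat) (s : 'I_k -> R).

Definition prefix_ideal (sg : 'S_k) (i : 'I_k) : R^o -> Prop :=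
  gen (fun y : R^o => exists2 j : 'I_k, (j < i)%N & y = s (sg j)).

Definition permutable_weak_regular : Prop :=
  forall (sg : 'S_k) (i : 'I_k) (x : R),
    prefix_ideal sg i (s (sg i) * x) -> prefix_ideal sg i x.

Definition smon (a : 'X_{1..k}) : R := \prod_(i < k) s i ^+ a i.

Definition is_sterm (x : R) : Prop :=
  exists (c : R) (a : 'X_{1..k}), c \is a GRing.unit /\ x = c * smon a.

End RegularSequences.

(* The pair (u, i) stands for the monomial u e_i of the free module. *)
Notation fmon n r := ('X_{1..n} * 'I_r)%type.

Section LeadingTerms.
Variables (R : comUnitRingType) (n r : nat).
Local Notation S := {mpoly R[n]}.
Local Notation F := 'rV[S]_r.

Definition mact (w : 'X_{1..n}) (p : fmon n r) : fmon n r :=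
  ((w + p.1)%MM, p.2).

Definition fmon_lt (le : rel (fmon n r)) (p q : fmon n r) : bool :=
  (p != q) && le p q.

Definition monomial_order (le : rel (fmon n r)) : Prop :=
  [/\ [/\ reflexive le, antisymmetric le, transitive le & total le],
      forall (w : 'X_{1..n}) (p : fmon n r),
        w != 0%MM -> fmon_lt le p (mact w p)
    & forall (w : 'X_{1..n}) (p q : fmon n r),
        fmon_lt le p q -> fmon_lt le (mact w p) (mact w q)].

Definition fsupp (f : F) : seq (fmon n r) :=
  [seq (u, i) | i <- enum 'I_r, u <- msupp (f ord0 i)].

Variable le : rel (fmon n r).

(* None exactly when f = 0. *)
Definition LM (f : F) : option (fmon n r) :=
  ohead (sort (fun p q => le q p) (fsupp f)).

Definition lc (f : F) : R :=
  if LM f is Some p then (f ord0 p.2)@_p.1 else 0.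

(* Junk value 0 at f = 0. *)
Definition lm (f : F) : 'X_{1..n} :=
  if LM f is Some p then p.1 else 0%MM.

Definition LT (f : F) : F :=
  if LM f is Some p then (lc f *: 'X_[p.1]) *: delta_mx ord0 p.2 else 0.

Definition same_component (f g : F) : bool :=
  if (LM f, LM g) is (Some p, Some q) then p.2 == q.2 else false.

Definition groebner_basis (U : F -> Prop) (m : nat) (f : 'I_m -> F) : Prop :=
  (forall i, U (f i)) /\
  forall v : F, gen (fun t => exists i, t = LT (f i)) v <->
                gen (fun t => exists2 x, U x & t = LT x) v.

Variables (k : nat) (s : 'I_k -> R).

Definition smonomial_type (f : F) : Prop := f != 0 /\ is_sterm s (lc f).

Section SPairs.
(* c i and s^(a i) are the unit and the s-monomial in lc (f i) = c_i b_i;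
   lcm(b_i, b_j) / b_i is then the s-monomial of exponent mlcm (a i) (a j) - a i. *)
Variables (m : nat) (f : 'I_m -> F) (c : 'I_m -> R) (a : 'I_m -> 'X_{1..k}).

Definition ucoef (i j : 'I_m) : S :=
  ((c i)^-1 * smon s (mlcm (a i) (a j) - a i)%MM)
    *: 'X_[(mlcm (lm (f i)) (lm (f j)) - lm (f i))%MM].

Definition Spair (i j : 'I_m) : F := ucoef i j *: f i - ucoef j i *: f j.

(* The conditions on the chosen coefficients q_(ij,l), l < m. *)
Definition standard_expr (i j : 'I_m) (q : 'I_m -> S) : Prop :=
  [/\ Spair i j = \sum_l q l *: f l,
      forall (l : 'I_m) (w : 'X_{1..n}) (p pl : fmon n r),
        w \in msupp (q l) -> LM (Spair i j) = Some p -> LM (f l) = Some pl ->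
        le (mact w pl) p
    & Spair i j = 0 -> forall l, q l = 0].

Variables (L : lmodType S) (g : 'I_m -> L).

Definition pair_syz (i j : 'I_m) (q : 'I_m -> S) : L :=
  ucoef i j *: g i - ucoef j i *: g j - \sum_l q l *: g l.

Definition Syz (x : L) : Prop :=
  exists h : 'I_m -> S, x = \sum_i h i *: g i /\ \sum_i h i *: f i = 0.

End SPairs.
End LeadingTerms.

(* Main.v *)
Require Import Defs.
From HB Require Import structures.
From mathcomp Require Import all_boot all_order all_fingroup all_algebra.
From mathcomp.multinomials Require Import mpoly.
From Stdlib Require Import Classical.

(** Each S-pair is a combination of the f_l with terms bounded by its leading
    monomial, so the r_ij are syzygies.  Conversely, let v be a syzygy and let M be
    the largest of the monomials w LM(f_l), for w a monomial of the l-th entry of v.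
    The coefficient of M in the sum of the v_l f_l involves the leading terms only
    (comb_top); it vanishes, and says that the top coefficients of v, multiplied by
    the units c_l, form a syzygy, over the base ring, of the s-monomials b_l with
    LM(f_l) dividing M.

    Syzygies of monomials in a permutable regular sequence are generated by the
    pairwise relations, just as for variables of a polynomial ring
    (monomial_syzygies).  This comes down to a formula for colon ideals
    (smon_regular): a monomial ideal E in the s_i satisfies
    (E : s^b) = (s^(d - b) : s^d a generator of E), with truncated subtraction.  The
    formula in turn follows from the regularity of s_j modulo any ideal generated
    by monomials not involving s_j (regular_mod_monideal), which is reduced to the
    definition of a regular sequence by induction on the degrees of the generators.

    A pair relation of b_i and b_j is the row of top coefficients of a monomial
    multiple of r_ij (shifted_rel_vec): the part of r_ij given by the q_(ij,l) is
    strictly smaller, because the leading terms cancel in the S-pair (q_strict).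
    Hence a combination of the r_ij can be subtracted from v so as to cancel all
    terms at M (cancel_top).  Monomial orders are well-founded, by Dickson's lemma
    (mo_ind), so repeating this step ends with 0. *)

Set Implicit Arguments.
Unset Strict Implicit.
Unset Printing Implicit Defensive.

Import GRing.Theory.
Local Open Scope ring_scope.

(** * Submodules and generated submodules *)

Section Generation.
Variables (A : comNzRingType) (V : lmodType A).

Section Closure.
Variables (H : V -> Prop) (hH : is_submodule H).

Lemma submod0 : H 0.
Proof. exact: hH.1. Qed.

Lemma submod_lin x v w : H v -> H w -> H (x *: v + w).
Proof. exact: hH.2. Qed.

Lemma submodD v w : H v -> H w -> H (v + w).
Proof. by move=> hv hw; rewrite -[v]scale1r; apply: hH.2. Qed.

Lemma submodZ (x : A) v : H v -> H (x *: v).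
Proof. by move=> hv; rewrite -[_ *: _]addr0; apply: hH.2 => //; apply: hH.1. Qed.

Lemma submodB v w : H v -> H w -> H (v - w).
Proof. by move=> hv hw; rewrite -scaleN1r; apply/submodD/submodZ. Qed.

Lemma submod_sum (I : finType) (F : I -> V) : (forall i, H (F i)) -> H (\sum_i F i).
Proof.
by move=> hF; elim/big_ind: _ => // [|v w]; [apply: hH.1 | apply: submodD].
Qed.

Lemma gen_min (G : V -> Prop) :
  (forall v, G v -> H v) -> forall v, gen G v -> H v.
Proof.
move=> hG v [N [x [y [hy ->]]]].
by apply: submod_sum => j; apply/submodZ/hG.
Qed.

End Closure.

Lemma gen_incl (G : V -> Prop) v : G v -> gen G v.
Proof.
by move=> hv; exists 1%N, (fun=> 1), (fun=> v); split; rewrite ?big_ord1 ?scale1r.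
Qed.

Lemma gen_submodule (G : V -> Prop) : is_submodule (gen G).
Proof.
split=> [|x v w [N [y [p [hp ->]]]] [N' [y' [p' [hp' ->]]]]].
  by exists 0%N, (fun=> 0), (fun=> 0); split; [case|rewrite big_ord0].
exists (N + N')%N,
  (fun i => match split i with inl j => x * y j | inr j => y' j end),
  (fun i => match split i with inl j => p j | inr j => p' j end).
split=> [i|]; first by case: split.
rewrite big_split_ord /= scaler_sumr; congr (_ + _); apply: eq_bigr => i _.
  by rewrite (unsplitK (inl i)) scalerA.
by rewrite (unsplitK (inr i)).
Qed.

Lemma genS (G H : V -> Prop) :
  (forall v, G v -> H v) -> forall v, gen G v -> gen H v.
Proof.
move=> hGH; apply: gen_min; first exact: gen_submodule.
by move=> v hv; apply/gen_incl/hGH.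
Qed.

End Generation.

(** * Ideals generated by monomials in a permutable regular sequence *)

Section MonomialIdeals.
Variables (R : comUnitRingType) (k : nat) (s : 'I_k -> R).
Hypothesis hs : permutable_weak_regular s.
Local Notation mon := 'X_{1..k}.

Lemma smonD (b d : mon) : smon s (b + d)%MM = smon s b * smon s d.
Proof.
by rewrite /smon -big_split; apply: eq_bigr => i _; rewrite mnmDE exprD.
Qed.

Lemma smon0 : smon s 0%MM = 1.
Proof. by rewrite /smon big1 // => i _; rewrite mnm0E expr0. Qed.

Lemma smon1 j : smon s U_(j)%MM = s j.
Proof.
rewrite /smon (bigD1 j) //= big1 ?mulr1 => [|i /negPf hi].
  by rewrite mnm1E eqxx expr1.
by rewrite mnm1E eq_sym hi expr0.
Qed.

Definition monideal (es : seq mon) : R^o -> Prop :=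
  gen (fun y : R^o => exists2 b, b \in es & y = smon s b).

Lemma monideal_submod es : is_submodule (monideal es).
Proof. exact: gen_submodule. Qed.

Lemma monideal_dvd (es : seq mon) (b d : mon) :
  b \in es -> (b <= d)%MM -> monideal es (smon s d).
Proof.
move=> hb /submK <-; rewrite smonD.
by apply: (submodZ (monideal_submod _)); apply: gen_incl; exists b.
Qed.

Lemma monideal_sub (es bs : seq mon) :
  (forall b, b \in es -> exists2 d, d \in bs & (d <= b)%MM) ->
  forall x, monideal es x -> monideal bs x.
Proof.
move=> h; apply: gen_min; first exact: monideal_submod.
by move=> _ [b /h [d hd hdb] ->]; apply: monideal_dvd hdb.
Qed.

Definition colon (es : seq mon) (b : mon) : seq mon := [seq (d - b)%MM | d <- es].

Definition free_of (j : 'I_k) (es : seq mon) : seq mon :=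
  [seq b : mon <- es | b j == 0%N].

(** Sorting the generators by whether they involve s_j separates the
    ideal modulo which s_j has to be shown regular from the part that is already
    divisible by s_j. *)
Lemma monideal_decomp es j x : monideal es x ->
  exists y z, [/\ monideal (free_of j es) y, monideal (colon es U_(j)) z
                & x = y + s j * z].
Proof.
move: x; apply: gen_min.
  split=> [|x v w [y [z [hy hz ->]]] [y' [z' [hy' hz' ->]]]].
    by exists 0, 0; split; rewrite ?mulr0 ?addr0 //;
      exact: (submod0 (monideal_submod _)).
  exists (x *: y + y'), (x *: z + z'); split.
    - exact: (submod_lin (monideal_submod (free_of j es))).
    - exact: (submod_lin (monideal_submod (colon es U_(j)))).
  by rewrite /GRing.scale /= !mulrDr addrACA mulrCA.
move=> _ [b hb ->]; have [hbj|hbj] := eqVneq (b j) 0%N.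
  exists (smon s b), 0; split; last by rewrite mulr0 addr0.
    by apply: gen_incl; exists b; rewrite // mem_filter hbj eqxx.
  by exact: (submod0 (monideal_submod _)).
exists 0, (smon s (b - U_(j))%MM); split.
- by exact: (submod0 (monideal_submod _)).
- by apply: gen_incl; exists (b - U_(j))%MM => //; apply: map_f.
by rewrite add0r -smon1 -smonD addmC submK // lep1mP.
Qed.

Lemma smon_mul_colon es b x : monideal (colon es b) x -> monideal es (smon s b * x).
Proof.
move: x; apply: gen_min.
  split=> [|x v w hv hw]; first by rewrite mulr0; exact: (submod0 (monideal_submod _)).
  rewrite mulrDr /GRing.scale /= mulrCA.
  exact: (submod_lin (monideal_submod _)).
move=> _ [_ /mapP [d hd ->] ->]; rewrite -smonD; apply: monideal_dvd hd _.
by apply/mnm_lepP => l; rewrite mnmDE mnmBE -leq_subLR.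
Qed.

Definition total_deg (es : seq mon) : nat := \sum_(b <- es) mdeg b.

Lemma total_deg_cat es bs :
  total_deg (es ++ bs) = (total_deg es + total_deg bs)%N.
Proof. exact: big_cat. Qed.

Lemma total_deg_filter (p : pred mon) es :
  (total_deg [seq b <- es | p b] + total_deg [seq b <- es | ~~ p b]
   = total_deg es)%N.
Proof.
by rewrite /total_deg !big_filter [RHS](bigID p).
Qed.

Lemma mdeg_filter_le (p : pred mon) (es : seq mon) b : b \in es -> p b ->
  (mdeg b <= total_deg [seq b <- es | p b])%N.
Proof.
move=> hb pb; have: b \in [seq b <- es | p b] by rewrite mem_filter pb.
by move=> h; rewrite /total_deg (big_rem b) //= leq_addr.
Qed.

Lemma exists_exponent (b : mon) : mdeg b != 0%N -> exists i, b i != 0%N.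
Proof.
move=> hb; apply/existsP; apply: contra_neqT hb => /existsPn h.
suff -> : b = 0%MM by rewrite mdeg0.
by apply/mnmP => l; rewrite mnm0E; apply/eqP/negPn/h.
Qed.

Lemma mdegB1 (b : mon) j : b j != 0%N -> mdeg b = (mdeg (b - U_(j))).+1.
Proof.
move=> h; rewrite -{1}(@submK _ U_(j)%MM b) ?lep1mP //.
by rewrite mdegD mdeg1 addn1.
Qed.

Lemma total_deg_colon (es : seq mon) (b : mon) j : b \in es -> b j != 0%N ->
  (total_deg (colon es U_(j)) < total_deg es)%N.
Proof.
move=> hb hbj; rewrite /total_deg big_map (big_rem b) //=.
rewrite [X in (_ < X)%N](big_rem b) //=.
rewrite (mdegB1 hbj) addSn ltnS leq_add2l; apply: leq_sum => d _.
have [h|/mdegB1 ->] := eqVneq (d j) 0%N; last exact: leqnSn.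
apply/eq_leq; congr mdeg; apply/mnmP => i; rewrite mnmBE mnm1E.
by case: eqP => [<-|]; rewrite ?h ?subn0.
Qed.

(** Permutability is available only through permutations of the whole sequence;
    this one lists T first and j immediately after, so that the initial ideal at
    the position of j is generated by the s_x with x in T. *)
Lemma perm_enumerating (T : {set 'I_k}) (j : 'I_k) : j \notin T ->
  exists (sg : 'S_k) (i : 'I_k), sg i = j /\
    forall x, (x \in T) <-> exists2 i' : 'I_k, (i' < i)%N & x = sg i'.
Proof.
move=> hj; pose l' := enum T ++ j :: enum (~: T :\ j).
have ul : uniq l'.
  rewrite cat_uniq /= !enum_uniq !mem_enum (negPf hj) !inE eqxx !andbT /=.
  by apply/hasPn => x; rewrite /= !mem_enum !inE => /andP [].
have sl : size l' = k.
  rewrite -[RHS]card_ord -(card_uniqP ul); apply: eq_card => x.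
  rewrite mem_cat in_cons !mem_enum !inE.
  by have [->|] := eqVneq x j; rewrite ?orbT //=; case: (x \in T).
have sT : (size (enum T) < k)%N.
  by apply: leq_trans (eq_leq sl); rewrite size_cat /= addnS ltnS leq_addr.
have inj : injective (fun i : 'I_k => nth j l' i).
  move=> i i' /eqP; rewrite nth_uniq ?sl // => /eqP; exact: val_inj.
exists (perm inj), (Ordinal sT); split=> [|x].
  by rewrite permE /= nth_cat ltnn subnn.
split=> [|[i' /= hi ->]].
  rewrite -mem_enum => hx.
  have hi : (index x (enum T) < size (enum T))%N by rewrite index_mem.
  exists (Ordinal (ltn_trans hi sT)) => //.
  by rewrite permE /= nth_cat hi nth_index.
by rewrite permE nth_cat hi -mem_enum mem_nth.
Qed.

(** The base case: an ideal generated by some of the s_i is an initial ideal of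
    a suitable permutation, unless 1 is among its generators. *)
Lemma regular_mod_variables es j x :
  (forall b, b \in es -> (mdeg b <= 1)%N) ->
  (forall b : mon, b \in es -> b j = 0%N) ->
  monideal es (s j * x) -> monideal es x.
Proof.
move=> hd hj hx; have [h0|h0] := boolP (0%MM \in es).
  rewrite -[x]mulr1 -smon0; apply: (submodZ (monideal_submod _)).
  by apply: gen_incl; exists 0%MM.
have [sg [i [hi hT]]] : exists (sg : 'S_k) (i : 'I_k), sg i = j /\
    forall x, x \in [set i | U_(i)%MM \in es]
         <-> exists2 i' : 'I_k, (i' < i)%N & x = sg i'.
  apply: perm_enumerating; rewrite inE; apply/negP => /hj.
  by rewrite mnm1E eqxx.
have E y : monideal es y <-> prefix_ideal s sg i y.
  split; apply: genS => v.
    case=> b hb ->; have := hd _ hb; rewrite leq_eqVlt ltnS leqn0 mdeg_eq0.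
    case/orP => [/mdeg1P [l /eqP hl]|/eqP hb0]; last by rewrite -hb0 hb in h0.
    rewrite hl in hb *; have [|i' hi' ->] := (hT l).1; first by rewrite inE.
    by exists i'; rewrite ?smon1.
  case=> i' hi' ->; exists (U_(sg i'))%MM; rewrite ?smon1 //.
  by have := (hT (sg i')).2; rewrite inE; apply; exists i'.
by apply/E/hs; rewrite hi; apply/E.
Qed.

(** Writing s_j x = y + s_j z as in monideal_decomp, x - z multiplies s_j into
    the ideal of the generators free of s_j, where s_j cancels. *)
Lemma colon_of_regular es j :
    (forall z, monideal (free_of j es) (s j * z) -> monideal (free_of j es) z) ->
  forall x, monideal es (s j * x) -> monideal (colon es U_(j)) x.
Proof.
move=> reg x /(@monideal_decomp _ j) [y [z [hy hz e]]].
have h : monideal (free_of j es) (x - z) by apply: reg; rewrite mulrBr e addrK.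
rewrite -[x](subrK z); apply: (submodD (monideal_submod _)) => //.
apply: monideal_sub h => b; rewrite mem_filter => /andP [_ hb].
exists (b - U_(j))%MM; first exact: map_f.
by apply/mnm_lepP => l; rewrite mnmBE leq_subr.
Qed.

(** Induction on the total degree of the generators.  If some generator has
    degree at least 2 and involves s_i, put E for the ideal.  The induction
    hypothesis covers E + (s_i), where every generator involving s_i collapses
    to s_i; the generators free of s_i, which yields the formula for (E : s_i)
    given by colon_of_regular; and the ideal (E : s_i) itself.  Then s_j x in E
    gives x = y + s_i z with y in E, hence s_i s_j z in E, hence s_j z and
    therefore z in (E : s_i), so that x lies in E. *)
Lemma regular_mod_monideal es j x : (forall b : mon, b \in es -> b j = 0%N) ->
  monideal es (s j * x) -> monideal es x.
Proof.
have [d] := ubnP (total_deg es); elim: d => // d IH in es j x *.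
rewrite ltnS => hd hj hx.
have [/allP h1|] := boolP (all (fun b => mdeg b <= 1)%N es).
  exact: regular_mod_variables h1 hj hx.
rewrite -has_predC => /hasP [b hb /=]; rewrite -ltnNge => hb2.
have [i hi] : exists i, b i != 0%N.
  by apply: exists_exponent; rewrite -lt0n; apply: ltnW.
have hij : i != j by apply: contra_neqN hi => /eqP ->; rewrite hj.
have colon_i z : monideal es (s i * z) -> monideal (colon es U_(i)) z.
  apply: colon_of_regular => {}z; apply: (IH _ i); last first.
    by move=> b'; rewrite mem_filter => /andP [/eqP].
  apply: leq_trans hd; rewrite -(total_deg_filter (fun b : mon => b i == 0%N) es).
  rewrite -[X in (X < _)%N]addn0 ltn_add2l.
  by apply: leq_trans (mdeg_filter_le hb hi); apply: ltnW.
pose bs := free_of i es ++ [:: U_(i)%MM].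
have hbs : monideal bs x.
  apply: (IH _ j).
  - apply: leq_trans hd; rewrite total_deg_cat.
    rewrite -(total_deg_filter (fun b : mon => b i == 0%N) es).
    rewrite ltn_add2l; apply: leq_trans (mdeg_filter_le hb hi).
    by rewrite /total_deg big_seq1 mdeg1.
  - move=> b'; rewrite mem_cat mem_filter inE => /orP [/andP [_ /hj] //|/eqP ->].
    by rewrite mnm1E (negPf hij).
  apply: monideal_sub hx => b' hb'; have [h|h] := eqVneq (b' i) 0%N.
    by exists b'; rewrite ?lepm_refl // mem_cat mem_filter h eqxx hb'.
  by exists U_(i)%MM; rewrite ?lep1mP // mem_cat inE eqxx orbT.
have [y [z [hy ex]]] : exists y z, monideal es y /\ x = y + s i * z.
  have [y [z [hy _ ->]]] := monideal_decomp i hbs.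
  exists y, z; split=> //; apply: monideal_sub hy => b'.
  rewrite /free_of filter_cat mem_cat !mem_filter inE.
  case/orP => [/andP [_ /andP [_ h]]|/andP [/eqP h /eqP h']]; last first.
    by rewrite h' mnm1E eqxx in h.
  by exists b'; rewrite ?lepm_refl.
rewrite ex in hx *.
have /colon_i hz : monideal es (s i * (s j * z)).
  have -> : s i * (s j * z) = s j * (y + s i * z) - s j * y.
    by rewrite mulrDr addrC addKr mulrCA.
  apply: (submodB (monideal_submod es)) => //.
  exact: (submodZ (monideal_submod es)).
have {}hz : monideal (colon es U_(i)) z.
  apply: (IH _ j) => //.
    exact: leq_trans (total_deg_colon hb hi) hd.
  by move=> _ /mapP [b' /hj h ->]; rewrite mnmBE h.
apply: (submodD (monideal_submod _)) => //.
by rewrite -smon1; apply: smon_mul_colon.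
Qed.

Lemma smon_regular_step es j x : monideal es (s j * x) ->
  monideal (colon es U_(j)) x.
Proof.
apply: colon_of_regular => z; apply: regular_mod_monideal => b.
by rewrite mem_filter => /andP [/eqP].
Qed.

(** The colon ideal of a monomial ideal by a monomial is computed on exponents,
    as in a polynomial ring; this is the only consequence of regularity that the
    study of syzygies needs. *)
Lemma smon_regular es b x : monideal es (smon s b * x) ->
  monideal (colon es b) x.
Proof.
have [d hd] : exists d, mdeg b = d by exists (mdeg b).
elim: d => [|d IH] in b hd es x *.
  move/eqP: hd; rewrite mdeg_eq0 => /eqP ->; rewrite smon0 mul1r.
  by apply: monideal_sub => b' hb'; exists b'; rewrite ?lepm_refl //;
    apply/mapP; exists b'; rewrite ?subm0.
have [i hi] : exists i, b i != 0%N.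
  by apply: exists_exponent; rewrite hd.
have hU : (U_(i) <= b)%MM by rewrite lep1mP.
rewrite -{1}(submK hU) addmC smonD smon1 -mulrA => /smon_regular_step.
move/IH => /(_ _)/= h; have {}h := h (succn_inj (etrans (esym (mdegB1 hi)) hd)).
suff -> : colon es b = colon (colon es U_(i)) (b - U_(i)) by [].
rewrite /colon -map_comp; apply: eq_map => d' /=.
by rewrite -{1}(submK hU) addmC submDA.
Qed.

Section Syzygies.
Variables (m : nat) (b : 'I_m -> mon).

Definition cofactor_mon (i j : 'I_m) : R := smon s (mlcm (b i) (b j) - b i)%MM.

Definition pair_relation (i j : 'I_m) : 'rV[R]_m :=
  cofactor_mon i j *: delta_mx 0 i - cofactor_mon j i *: delta_mx 0 j.

Definition relation_span (J : pred 'I_m) : 'rV[R]_m -> Prop :=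
  gen (fun v => exists i j : 'I_m, [/\ (i < j)%N, J i, J j & v = pair_relation i j]).

Lemma pair_relationE i j l : pair_relation i j 0 l =
  cofactor_mon i j * (l == i)%:R - cofactor_mon j i * (l == j)%:R.
Proof. by rewrite !mxE eqxx. Qed.

Lemma sum_delta (V : lmodType R) (x : R) (i : 'I_m) (v : 'I_m -> V) :
  \sum_l (x * (l == i)%:R) *: v l = x *: v i.
Proof.
rewrite (bigD1 i) //= eqxx mulr1 big1 ?addr0 // => l /negPf ->.
by rewrite mulr0 scale0r.
Qed.

Lemma pair_relation_syz i j : \sum_l pair_relation i j 0 l * smon s (b l) = 0.
Proof.
have E i' j' : \sum_l (cofactor_mon i' j' * (l == i')%:R) * smon s (b l)
             = smon s (mlcm (b i') (b j')).
  rewrite (@sum_delta R^o) /GRing.scale /= /cofactor_mon -smonD submK //.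
  exact: lem_mlcml.
under eq_bigr do rewrite pair_relationE mulrBl.
by rewrite sumrB !E mlcmC subrr.
Qed.

(** The last nonzero entry of a syzygy, at position l0, lies in the colon ideal of the monomials
    of smaller index by the monomial of index l0, hence is a combination of
    the quotients lcm / b_l0.  Those quotients are the last entries of pair
    relations, and subtracting these shortens the syzygy.  The set J restricts
    the whole argument to the positions where a given monomial of the free module
    is divisible by the leading monomial. *)
Lemma monomial_syzygies (J : pred 'I_m) (t : 'rV[R]_m) :
    (forall l, ~~ J l -> t 0 l = 0) -> \sum_l t 0 l * smon s (b l) = 0 ->
  relation_span J t.
Proof.
move=> hJ hsyz; have [p ht] : exists p, forall l : 'I_m, (p <= l)%N -> t 0 l = 0.
  by exists m => l; rewrite leqNgt ltn_ord.
elim: p => [|p IH] in t ht hJ hsyz *.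
  suff -> : t = 0 by apply: submod0 (gen_submodule _).
  by apply/rowP => l; rewrite ht // mxE.
have [hp|hp] := leqP m p.
  by apply: IH => // l /(leq_trans hp); rewrite leqNgt ltn_ord.
pose l0 := Ordinal hp.
have lgt (l : 'I_m) : (p <= l)%N -> l != l0 -> t 0 l = 0.
  by move=> hl hl0; apply: ht; rewrite ltn_neqAle hl andbT eq_sym.
have [hl0|hl0] := boolP (J l0); last first.
  by apply: IH => // l hl; have [->|/lgt->//] := eqVneq l l0; apply: hJ.
pose es := [seq b i | i : 'I_m <- enum 'I_m & (i < p)%N && J i].
have hcol : monideal es (smon s (b l0) * t 0 l0).
  have -> : smon s (b l0) * t 0 l0 = - \sum_(l | l != l0) t 0 l * smon s (b l).
    by move: hsyz; rewrite (bigD1 l0) //= mulrC => /eqP; rewrite addr_eq0 => /eqP.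
  rewrite -mulN1r; apply: (submodZ (monideal_submod es)).
  apply: big_ind => [|v w|l hl]; first exact: (submod0 (monideal_submod es)).
    exact: (submodD (monideal_submod es)).
  have [hlp|/lgt-> //] := ltnP l p; last first.
    by rewrite mul0r; exact: (submod0 (monideal_submod es)).
  have [hJl|/hJ ->] := boolP (J l); last first.
    by rewrite mul0r; exact: (submod0 (monideal_submod es)).
  apply: (submodZ (monideal_submod es)); apply: (@monideal_dvd _ (b l)).
    by apply: map_f; rewrite mem_filter hlp hJl mem_enum.
  exact: lepm_refl.
(* The last entries that can be cancelled by pair relations form an ideal. *)
pose H (x : R^o) := exists v : 'rV[R]_m, [/\ relation_span J v, v 0 l0 = x,
  forall l : 'I_m, (p < l)%N -> v 0 l = 0,
  forall l, ~~ J l -> v 0 l = 0 & \sum_l v 0 l * smon s (b l) = 0].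
have hH : is_submodule H.
  split=> [|x _ _ [v [hv <- v1 v2 v3]] [w [hw <- w1 w2 w3]]].
    exists 0; split; rewrite ?mxE //; try by move=> *; rewrite mxE.
      exact: (submod0 (gen_submodule _)).
    by rewrite big1 // => l _; rewrite mxE mul0r.
  exists (x *: v + w); split=> [||l hl|l hl|].
  - exact: (submod_lin (gen_submodule _)).
  - by rewrite !mxE.
  - by rewrite !mxE v1 // w1 // mulr0 addr0.
  - by rewrite !mxE v2 // w2 // mulr0 addr0.
  under eq_bigr do rewrite !mxE mulrDl -mulrA.
  by rewrite big_split /= -mulr_sumr v3 w3 mulr0 addr0.
have [v [hv vl0 v1 v2 v3]] : H (t 0 l0).
  move: (smon_regular hcol); apply: (gen_min hH) => x [d /mapP [d' hd' ->]].
  case/mapP: hd' => i; rewrite mem_filter => /andP [/andP [hip hJi] _] -> ->.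
  have hil : l0 == i = false by apply/negbTE; rewrite neq_ltn hip orbT.
  exists (- pair_relation i l0); split=> [||l hl|l hl|].
  - rewrite -scaleN1r; apply: (submodZ (gen_submodule _)).
    by apply: gen_incl; exists i, l0.
  - rewrite mxE pair_relationE hil eqxx mulr0 sub0r opprK mulr1.
    by rewrite /cofactor_mon mlcmE addmC addmK.
  - rewrite mxE pair_relationE; have [li|_] := eqVneq l i.
      by rewrite li ltnNge (ltnW hip) in hl.
    have [ll|_] := eqVneq l l0; first by rewrite ll ltnn in hl.
    by rewrite !mulr0 subrr oppr0.
  - rewrite mxE pair_relationE; have [li|_] := eqVneq l i.
      by rewrite li hJi in hl.
    have [ll|_] := eqVneq l l0; first by rewrite ll hl0 in hl.
    by rewrite !mulr0 subrr oppr0.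
  - under eq_bigr do rewrite mxE mulNr.
    by rewrite sumrN pair_relation_syz oppr0.
rewrite -[t](subrK v); apply: (submodD (gen_submodule _)) => //.
apply: IH => [l hl|l hl|].
- rewrite !mxE; have [->|hne] := eqVneq l l0; first by rewrite vl0 subrr.
  rewrite lgt // v1 ?subr0 // ltn_neqAle hl andbT; apply: contra hne.
  by move/eqP => h; apply/eqP/val_inj.
- by rewrite !mxE hJ // v2 // subr0.
under eq_bigr do rewrite !mxE mulrBl.
by rewrite sumrB hsyz v3 subr0.
Qed.

End Syzygies.
End MonomialIdeals.

(** * Dickson's lemma and well-foundedness of monomial orders *)

Section Dickson.
Variable n : nat.
Local Notation mon := 'X_{1..n}.

(** Dickson's lemma for divisibility tested on the coordinates in cs only, which
    makes an induction on the number of coordinates possible.  Given a basis B0 for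
    the coordinates cs, an element is covered by B0 also at a further coordinate i
    as soon as its i-th exponent reaches the maximum N over B0; there remain the
    finitely many slices with i-th exponent below N, each having its own basis. *)
Lemma dickson_coords (cs : seq 'I_n) (P : mon -> Prop) :
  exists B : seq mon, (forall b, b \in B -> P b) /\
    forall u, P u -> exists2 b, b \in B & forall i, i \in cs -> (b i <= u i)%N.
Proof.
elim: cs => [|i cs IH] in P *.
  case: (classic (exists u, P u)) => [[u hu]|h].
    by exists [:: u]; split=> [b|v _]; [rewrite inE => /eqP -> | exists u; rewrite ?inE].
  by exists [::]; split=> // u hu; case: h; exists u.
have [B0 [hB0 cover0]] := IH P.
pose N := \max_(b <- B0) b i.
have [B1 [hB1 cover1]] : exists B1 : seq mon, (forall b, b \in B1 -> P b) /\
    forall u, P u -> (u i < N)%N ->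
      exists2 b, b \in B1 & forall j, j \in i :: cs -> (b j <= u j)%N.
  elim: N => [|N [B1 [hB1 cover1]]]; first by exists [::].
  have [B2 [hB2 cover2]] := IH (fun u => P u /\ u i = N).
  exists (B1 ++ B2); split=> [b|u hu]; first by rewrite mem_cat => /orP [/hB1|/hB2 []].
  rewrite ltnS leq_eqVlt => /orP [/eqP hN|/(cover1 _ hu) [b hb h]]; last first.
    by exists b; rewrite ?mem_cat ?hb.
  have [//|b hb h] := cover2 u; exists b; rewrite ?mem_cat ?hb ?orbT // => j.
  by rewrite inE => /predU1P [->|/h //]; rewrite hN (hB2 _ hb).2.
exists (B0 ++ B1); split=> [b|u hu]; first by rewrite mem_cat => /orP [/hB0|/hB1].
have [hN|/(cover1 _ hu) [b hb h]] := leqP N (u i); last first.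
  by exists b; rewrite ?mem_cat ?hb ?orbT.
have [b hb h] := cover0 _ hu; exists b; rewrite ?mem_cat ?hb // => j.
rewrite inE => /predU1P [->|/h //]; apply: leq_trans hN.
by rewrite /N (big_rem b) //= leq_maxl.
Qed.

Lemma dickson (P : mon -> Prop) :
  exists B : seq mon, (forall b, b \in B -> P b) /\
    forall u, P u -> exists2 b, b \in B & (b <= u)%MM.
Proof.
have [B [hB cover]] := dickson_coords (enum 'I_n) P.
exists B; split=> // u /cover [b hb h]; exists b => //.
by apply/mnm_lepP => i; apply: h; rewrite mem_enum.
Qed.
End Dickson.

Lemma sort_head (T : eqType) (rT : rel T) (l : seq T) :
    transitive rT -> total rT -> l != [::] ->
  exists p, [/\ ohead (sort rT l) = Some p, p \in l & forall q, q \in l -> rT p q].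
Proof.
move=> rT_trans rT_total hl; have := sort_sorted rT_total l.
case E: (sort rT l) => [|p l'] /=.
  by move: hl; rewrite -size_eq0 -(size_sort rT) E.
move=> /(order_path_min rT_trans) /allP hp; exists p; split=> // [|q].
  by rewrite -(mem_sort rT) E mem_head.
rewrite -(mem_sort rT) E inE => /predU1P [->|/hp //].
by have := rT_total p p; rewrite orbb.
Qed.

(* Multiplication of monomials of the free module, as opposed to the group action
   induced by a morphism, which has the same name. *)
Local Notation mact := Defs.mact.

Section MonomialOrder.
Variables (n r : nat) (le : rel (fmon n r)).
Hypothesis hle : monomial_order le.

Lemma mo_refl p : le p p.
Proof. by case: hle => [[]]. Qed.

Lemma mo_anti p q : le p q -> le q p -> p = q.
Proof. by case: hle => [[_ h _ _] _ _] h1 h2; apply: h; rewrite h1. Qed.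

Lemma mo_trans : transitive le.
Proof. by case: hle => [[]]. Qed.

Lemma mo_total : total le.
Proof. by case: hle => [[]]. Qed.

Lemma mact0 (p : fmon n r) : mact 0%MM p = p.
Proof. by case: p => u i; rewrite /mact /= add0m. Qed.

Lemma mactD w w' (p : fmon n r) : mact (w + w')%MM p = mact w (mact w' p).
Proof. by rewrite /mact /= addmA. Qed.

Lemma le_mact w p : le p (mact w p).
Proof.
have [->|hw] := eqVneq w 0%MM; first by rewrite mact0 mo_refl.
by case: hle => _ /(_ _ p hw) /andP [].
Qed.

Lemma lt_mact w p q : fmon_lt le p q -> fmon_lt le (mact w p) (mact w q).
Proof. by case: hle => _ _; apply. Qed.

Lemma mact_le w p q : le p q -> le (mact w p) (mact w q).
Proof.
move=> h; have [->|hpq] := eqVneq p q; first exact: mo_refl.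
by have /(lt_mact w) /andP [] : fmon_lt le p q by rewrite /fmon_lt hpq h.
Qed.

Lemma le_lt_trans p q t : le p q -> fmon_lt le q t -> fmon_lt le p t.
Proof.
move=> hpq /andP [hqt hqt']; rewrite /fmon_lt (mo_trans hpq hqt') andbT.
by apply: contraNneq hqt => e; rewrite -e in hqt' *; apply/eqP/mo_anti.
Qed.

(** A monomial order refines divisibility, so the least element of a finite
    divisibility basis is least in the whole set. *)
Lemma mo_min (P : fmon n r -> Prop) p0 : P p0 ->
  exists2 p, P p & forall q, P q -> le p q.
Proof.
move=> hp0.
have [B [hB cover]] : exists B : seq (fmon n r), (forall b, b \in B -> P b) /\
    forall q, P q -> exists2 b, b \in B & le b q.
  have [B [hB cover]] : exists B : seq (fmon n r), (forall b, b \in B -> P b) /\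
      forall q, P q -> q.2 \in enum 'I_r -> exists2 b, b \in B & le b q.
    elim: (enum _) => [|i l [B [hB cover]]]; first by exists [::].
    have [D [hD coverD]] := dickson (fun u => P (u, i)).
    exists (B ++ [seq (u, i) | u <- D]); split=> [b|[u j] hu].
      by rewrite mem_cat => /orP [/hB //|/mapP [u /hD h ->]].
    rewrite inE /= => /predU1P [ej|/(cover _ hu) [b hb h]]; last first.
      by exists b; rewrite ?mem_cat ?hb.
    rewrite {j}ej in hu *; have [d hd hdu] := coverD _ hu.
    exists (d, i); first by rewrite mem_cat map_f ?orbT.
    by rewrite -(submK hdu); apply: le_mact.
  by exists B; split=> // q hq; apply: cover; rewrite // mem_enum.
have [|p [_ hp hmin]] := @sort_head _ le B mo_trans mo_total.
  by have [b + _] := cover _ hp0; case: (B) => [|? ?].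
exists p => [|q /cover [b /hmin h]]; [exact: hB | exact: mo_trans].
Qed.

(** Infinitely many monomials may lie below a given one, as in lexicographic orders;
    the cancellation of top terms terminates by this induction principle. *)
Lemma mo_ind (Q : fmon n r -> Prop) :
  (forall p, (forall q, fmon_lt le q p -> Q q) -> Q p) -> forall p, Q p.
Proof.
move=> step p; apply: NNPP => /(@mo_min (fun p => ~ Q p)) [q hq hmin].
apply: hq; apply: step => t /andP [htq hle']; apply: NNPP => /hmin h.
by rewrite (mo_anti hle' h) eqxx in htq.
Qed.

End MonomialOrder.

(** * Leading terms of combinations *)

Section LeadingTermsOfCombinations.
Variables (R : comUnitRingType) (n r : nat) (le : rel (fmon n r)).
Hypothesis hle : monomial_order le.
Local Notation S := {mpoly R[n]}.
Local Notation F := 'rV[S]_r.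

Definition fcoef (f : F) (p : fmon n r) : R := (f ord0 p.2)@_p.1.

Lemma mem_fsupp f p : (p \in fsupp f) = (fcoef f p != 0).
Proof.
rewrite -mcoeff_msupp; apply/allpairsPdep/idP => [[i [u [_ hu ->]]] //|hp].
by exists p.2, p.1; split; rewrite ?mem_enum //; case: (p).
Qed.

Lemma LM_exists (f : F) : f != 0 -> exists p, LM le f = Some p.
Proof.
move=> hf; rewrite /LM.
have [||//|p [-> _ _]] := @sort_head _ (fun p q => le q p) (fsupp f); last by exists p.
- by move=> q p t h1 h2; apply: mo_trans h2 h1.
- by move=> p q; apply: mo_total.
apply: contraNneq hf => e; apply/eqP/rowP => i; rewrite mxE; apply/mpolyP => u.
rewrite mcoeff0; apply/eqP/negPn/negP => h.
have : (u, i) \in fsupp f by rewrite mem_fsupp.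
by rewrite e.
Qed.

Lemma LM_max (f : F) p : LM le f = Some p ->
  fcoef f p != 0 /\ forall q, fcoef f q != 0 -> le q p.
Proof.
rewrite /LM => hp.
have [|||p' [e h1 h2]] := @sort_head _ (fun p q => le q p) (fsupp f).
- by move=> q p' t h1 h2; apply: mo_trans h2 h1.
- by move=> p' q; apply: mo_total.
- by apply/eqP => e; rewrite e in hp.
move: hp; rewrite e => [[<-]]; rewrite -mem_fsupp; split=> // q.
by rewrite -mem_fsupp; apply: h2.
Qed.

Lemma lcE (f : F) p : LM le f = Some p -> lc le f = fcoef f p.
Proof. by rewrite /lc => ->. Qed.

Lemma mcoeff_mulX (g : S) w u :
  ('X_[w] * g)@_u = if (w <= u)%MM then g@_(u - w) else 0.
Proof.
rewrite -commr_mpolyX; case: ifPn => [/submK e|h].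
  by rewrite -{1}e addmC mcoeffMX.
apply/eqP; rewrite mcoeff_eq0 (perm_mem (msuppMX _ _)).
by apply: contra h => /mapP [w' _ ->]; apply/mnm_lepP => i; rewrite mnmDE leq_addr.
Qed.

Lemma fcoef_scale (h : S) f q : fcoef (h *: f) q =
  \sum_(w <- msupp h) h@_w * (if (w <= q.1)%MM then fcoef f (q.1 - w, q.2)%MM else 0).
Proof.
rewrite /fcoef mxE {1}[h]mpolyE mulr_suml linear_sum /=.
by apply: eq_bigr => w _; rewrite -scalerAl mcoeffZ mcoeff_mulX.
Qed.

Definition fmon_dvd (p M : fmon n r) : bool := (p.2 == M.2) && (p.1 <= M.1)%MM.

(** With p the leading monomial of f, this bounds all terms of the product h f. *)
Definition below (M p : fmon n r) (h : S) : Prop :=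
  forall w, h@_w != 0 -> le (mact w p) M.

(** The coefficient of h that meets the leading term of f at M in the product h f,
    where p is the leading monomial of f. *)
Definition topcoef (M p : fmon n r) (h : S) : R :=
  if fmon_dvd p M then h@_(M.1 - p.1) else 0.

Lemma below_submodule M p : is_submodule (below M p).
Proof.
split=> [w|x h h' hh hh' w]; first by rewrite mcoeff0 eqxx.
rewrite mcoeffD mcoeffZ; have [-> |/hh //] := eqVneq (h@_w) 0.
by rewrite mulr0 add0r => /hh'.
Qed.

Lemma topcoef_lin M p x h h' :
  topcoef M p (x *: h + h') = x * topcoef M p h + topcoef M p h'.
Proof.
by rewrite /topcoef; case: ifP => _; rewrite ?mulr0 ?addr0 // mcoeffD mcoeffZ.
Qed.

Lemma topcoefB M p h h' :
  topcoef M p (h - h') = topcoef M p h - topcoef M p h'.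
Proof. by rewrite addrC -scaleN1r topcoef_lin mulN1r addrC. Qed.

Lemma topcoefZ M p x h : topcoef M p (x *: h) = x * topcoef M p h.
Proof.
by rewrite /topcoef; case: ifP => _; rewrite ?mulr0 // mcoeffZ.
Qed.

Lemma monomial_below M p w : mact w p = M -> below M p 'X_[w].
Proof.
move=> <- w'; rewrite mcoeffX.
by have [->|] := eqVneq w w'; rewrite ?eqxx // => _; apply: mo_refl.
Qed.

Lemma monomial_topcoef M p w : mact w p = M -> topcoef M p 'X_[w] = 1.
Proof.
move=> <-; rewrite /topcoef /fmon_dvd /= eqxx addmK mcoeffX eqxx.
by rewrite ifT //; apply/mnm_lepP => i; rewrite mnmDE leq_addl.
Qed.

Lemma strict_topcoef M p h : (forall w, h@_w != 0 -> fmon_lt le (mact w p) M) <->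
  below M p h /\ topcoef M p h = 0.
Proof.
split=> [hlt|[hb ht] w hw]; last first.
  rewrite /fmon_lt hb // andbT; apply: contraNneq hw => e.
  move: ht; rewrite -e /topcoef /fmon_dvd /= eqxx addmK ifT => [->//|].
  by apply/mnm_lepP => i; rewrite mnmDE leq_addl.
split=> [w /hlt /andP [] //|]; rewrite /topcoef; case: ifP => // /andP [/eqP e hd].
apply/eqP/negPn/negP => /hlt /andP [/eqP []].
by rewrite /mact submK // e; case: (M).
Qed.

Section OneMultiple.
Variables (f : F) (p M : fmon n r) (h : S).
Hypotheses (hp : LM le f = Some p) (hM : below M p h).

Lemma fcoef_scale_le q : fcoef (h *: f) q != 0 -> le q M.
Proof.
rewrite fcoef_scale => hq; apply/negPn/negP => hqM; case/eqP: hq.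
rewrite big_seq big1 // => w; rewrite mcoeff_msupp => /hM hw.
case: ifP => hwq; rewrite ?mulr0 //.
have [e|hfc] := eqVneq (fcoef f (q.1 - w, q.2)%MM) 0; first by rewrite e mulr0.
case/negP: hqM; apply: mo_trans hw => //.
have -> : q = mact w (q.1 - w, q.2)%MM by rewrite /mact /= addmC submK //; case: (q).
by apply: mact_le => //; apply: (LM_max hp).2.
Qed.

(** No other pair of terms can contribute at M: a nonleading term of f times a term
    w of h lies strictly below w p, which is at most M. *)
Lemma fcoef_scale_top : fcoef (h *: f) M = topcoef M p h * lc le f.
Proof.
have term0 w : h@_w != 0 -> mact w p != M ->
    h@_w * (if (w <= M.1)%MM then fcoef f (M.1 - w, M.2)%MM else 0) = 0.
  move=> hw hwM; case: ifP => hwd; rewrite ?mulr0 //.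
  have [->|hfc] := eqVneq (fcoef f (M.1 - w, M.2)%MM) 0; first by rewrite mulr0.
  have e : M = mact w (M.1 - w, M.2)%MM by rewrite /mact /= addmC submK //; case: (M).
  case/eqP: hwM; apply: mo_anti (hM hw) _ => //.
  by rewrite [X in le X]e; apply: mact_le => //; apply: (LM_max hp).2.
rewrite fcoef_scale (lcE hp) /topcoef; case: ifPn => [/andP [/eqP e hd]|hd]; last first.
  rewrite mul0r big_seq big1 // => w; rewrite mcoeff_msupp => /term0; apply.
  apply: contraNneq hd => <-; rewrite /fmon_dvd /= eqxx.
  by apply/mnm_lepP => i; rewrite mnmDE leq_addl.
set d := (M.1 - p.1)%MM.
have dP : (d <= M.1)%MM by apply/mnm_lepP => i; rewrite mnmBE leq_subr.
have pE : (M.1 - d, M.2)%MM = p.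
  rewrite -e; case: (p) hd @d {dP} => u i /= hd.
  by congr pair; rewrite -{1}(submK hd) addmC addmK.
have termd : h@_d * (if (d <= M.1)%MM then fcoef f (M.1 - d, M.2)%MM else 0)
    = h@_d * fcoef f p by rewrite dP pE.
have term_other w : w != d -> h@_w != 0 ->
    h@_w * (if (w <= M.1)%MM then fcoef f (M.1 - w, M.2)%MM else 0) = 0.
  move=> hwd hw; apply: term0 => //; apply: contra hwd => /eqP e'.
  by rewrite /d -e' /= addmK.
have [hdn|hdn] := boolP (d \in msupp h).
  rewrite (bigD1_seq d) //= termd big_seq_cond big1 ?addr0 // => w /andP [].
  by rewrite mcoeff_msupp => h1 h2; apply: term_other.
rewrite (memN_msupp_eq0 hdn) mul0r big_seq big1 // => w hw.
apply: term_other; last by rewrite -mcoeff_msupp.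
by apply: contraNneq hdn => <-.
Qed.

End OneMultiple.
End LeadingTermsOfCombinations.

(** * Lifting syzygies of leading coefficients *)

Section Schreyer.
Variables (R : comUnitRingType) (n r : nat) (le : rel (fmon n r)).
Hypothesis hle : monomial_order le.
Local Notation S := {mpoly R[n]}.
Local Notation F := 'rV[S]_r.
Variables (k : nat) (s : 'I_k -> R).
Hypothesis hs : permutable_weak_regular s.
Variables (m : nat) (f : 'I_m -> F) (c : 'I_m -> R) (a : 'I_m -> 'X_{1..k}).
Variable pl : 'I_m -> fmon n r.
Hypothesis hpl : forall i, LM le (f i) = Some (pl i).
Hypothesis hc : forall i, c i \is a GRing.unit.
Hypothesis hca : forall i, lc le (f i) = c i * smon s (a i).
Variable q : 'I_m -> 'I_m -> 'I_m -> S.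
Hypothesis hq : forall i j : 'I_m, (i < j)%N -> same_component le (f i) (f j) ->
  standard_expr le s f c a i j (q i j).

Definition comb (V : lmodType S) (v : 'rV[S]_m) (g : 'I_m -> V) : V :=
  \sum_l v 0 l *: g l.

Lemma comb_lin (V : lmodType S) (x : S) v w (g : 'I_m -> V) :
  comb (x *: v + w) g = x *: comb v g + comb w g.
Proof.
rewrite /comb scaler_sumr -big_split; apply: eq_bigr => l _ /=.
by rewrite !mxE scalerDl scalerA.
Qed.

Lemma combB (V : lmodType S) v w (g : 'I_m -> V) :
  comb (v - w) g = comb v g - comb w g.
Proof. by have := comb_lin (-1) w v g; rewrite !scaleN1r ![- _ + _]addrC. Qed.

Lemma comb0 (V : lmodType S) (g : 'I_m -> V) : comb 0 g = 0.
Proof. by rewrite /comb big1 // => l _; rewrite mxE scale0r. Qed.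

Definition vbelow (M : fmon n r) (v : 'rV[S]_m) : Prop :=
  forall l, below le M (pl l) (v 0 l).

Definition vstrict (M : fmon n r) (v : 'rV[S]_m) : Prop :=
  forall l w, (v 0 l)@_w != 0 -> fmon_lt le (mact w (pl l)) M.

Definition top_row (M : fmon n r) (v : 'rV[S]_m) : 'rV[R]_m :=
  \row_l (c l * topcoef M (pl l) (v 0 l)).

Lemma top_rowB M v w : top_row M (v - w) = top_row M v - top_row M w.
Proof. by apply/rowP => l; rewrite !mxE topcoefB mulrBr. Qed.

Lemma vbelowB M v w : vbelow M v -> vbelow M w -> vbelow M (v - w).
Proof. by move=> hv hw l; rewrite !mxE; apply: (submodB (below_submodule _ _ _ _)). Qed.

Lemma vstrictP M v : vstrict M v <-> vbelow M v /\ top_row M v = 0.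
Proof.
split=> [h|[hb ht] l].
  split=> [l|]; first by case/strict_topcoef: (h l).
  by apply/rowP => l; rewrite !mxE; case/strict_topcoef: (h l) => _ ->; rewrite mulr0.
apply/strict_topcoef; split; first exact: hb.
by apply: (mulrI (hc l)); rewrite mulr0; move/rowP/(_ l): ht; rewrite !mxE.
Qed.

Lemma comb_le M v p : vbelow M v -> fcoef (comb v f) p != 0 -> le p M.
Proof.
move=> hv; apply: contraNT => hp.
rewrite /fcoef /comb summxE raddf_sum big1 // => l _.
by apply/eqP; apply: contraNT hp; apply: (fcoef_scale_le hle (hpl l) (hv l)).
Qed.

(** Multiplying by the units c l in the definition of top_row turns the coefficient at M
    into a plain combination of s-monomials, so that for a syzygy the row top_row M v is
    a syzygy of s-monomials over the base ring. *)
Lemma comb_top M v : vbelow M v ->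
  fcoef (comb v f) M = \sum_l top_row M v 0 l * smon s (a l).
Proof.
move=> hv; rewrite {1}/fcoef /comb summxE raddf_sum /=; apply: eq_bigr => l _.
rewrite -[LHS]/(fcoef (v 0 l *: f l) M) (fcoef_scale_top hle (hpl l) (hv l)) hca.
by rewrite mxE mulrA [c l * _]mulrC.
Qed.

Lemma vbelow_attained (v : 'rV[S]_m) : v != 0 ->
  exists l w, (v 0 l)@_w != 0 /\ vbelow (mact w (pl l)) v.
Proof.
move=> hv; pose terms : seq (fmon n r) :=
  [seq mact w (pl l) | l <- enum 'I_m, w <- msupp (v 0 l)].
have termsP l w : (v 0 l)@_w != 0 -> mact w (pl l) \in terms.
  by move=> h; apply/allpairsPdep; exists l, w; rewrite mem_enum mcoeff_msupp.
have hne : terms != [::].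
  apply: contraNneq hv => e; apply/eqP/rowP => l; rewrite mxE.
  apply/mpolyP => w; rewrite mcoeff0.
  by apply/eqP/negPn/negP => /termsP; rewrite e.
have [||M' [_ hM' hmax]] := @sort_head _ (fun p q => le q p) _ _ _ hne.
- by move=> x y z h1 h2; apply: mo_trans h2 h1.
- by move=> x y; apply: mo_total.
case/allpairsPdep: hM' hmax => l [w [_ hw ->]] hmax.
by exists l, w; rewrite -mcoeff_msupp; split=> // l' w' /termsP /hmax.
Qed.

Definition pair_vec (i j : 'I_m) : 'rV[S]_m :=
  ucoef le s f c a i j *: delta_mx 0 i - ucoef le s f c a j i *: delta_mx 0 j.

Definition rel_vec (i j : 'I_m) : 'rV[S]_m := pair_vec i j - \row_l q i j l.

Lemma comb_delta (V : lmodType S) x i (g : 'I_m -> V) :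
  comb (x *: delta_mx 0 i) g = x *: g i.
Proof.
rewrite /comb (bigD1 i) //= big1 => [|l /negPf hl].
  by rewrite !mxE !eqxx mulr1 addr0.
by rewrite !mxE hl andbF mulr0 scale0r.
Qed.

Lemma comb_pair_vec (V : lmodType S) i j (g : 'I_m -> V) :
  comb (pair_vec i j) g = ucoef le s f c a i j *: g i - ucoef le s f c a j i *: g j.
Proof. by rewrite combB !comb_delta. Qed.

Lemma comb_rel_vec (V : lmodType S) i j (g : 'I_m -> V) :
  comb (rel_vec i j) g = pair_syz le s f c a g i j (q i j).
Proof.
by rewrite combB comb_pair_vec; congr (_ - _); apply: eq_bigr => l _; rewrite mxE.
Qed.

Lemma same_componentE i j : same_component le (f i) (f j) = ((pl i).2 == (pl j).2).
Proof. by rewrite /same_component !hpl. Qed.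

Lemma comb_rel_vec_f (i j : 'I_m) : (i < j)%N -> (pl i).2 = (pl j).2 ->
  comb (rel_vec i j) f = 0.
Proof.
move=> hij hs2; rewrite comb_rel_vec /pair_syz.
have [|e _ _] := hq hij; first by rewrite same_componentE hs2.
by rewrite -[X in X - _]/(Spair le s f c a i j) e subrr.
Qed.

(** The S-pair vectors lift the pair relations of s-monomials: M being divisible by
    both leading monomials, the multiple of the vector that sits at M has the pair
    relation as its row of top coefficients. *)
Lemma shifted_pair_vec M i j : i != j -> fmon_dvd (pl i) M -> fmon_dvd (pl j) M ->
  let d := (M.1 - mlcm (pl i).1 (pl j).1)%MM in
  vbelow M ('X_[d] *: pair_vec i j) /\
  top_row M ('X_[d] *: pair_vec i j) = pair_relation s a i j.
Proof.
move=> hij hi hj d.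
have term i' j' : fmon_dvd (pl i') M -> d = (M.1 - mlcm (pl i').1 (pl j').1)%MM ->
    (mlcm (pl i').1 (pl j').1 <= M.1)%MM ->
  exists2 e, mact e (pl i') = M
    & 'X_[d] * ucoef le s f c a i' j' = ((c i')^-1 * cofactor_mon s a i' j') *: 'X_[e].
  case/andP=> /eqP hi2 hi1 dE hlcm.
  exists (d + (mlcm (pl i').1 (pl j').1 - (pl i').1))%MM.
    rewrite /mact -addmA submK ?lem_mlcml // dE submK //.
    by rewrite hi2; case: (M).
  by rewrite /ucoef /lm !hpl -scalerAr -mpolyXD.
have hlcm : (mlcm (pl i).1 (pl j).1 <= M.1)%MM.
  by rewrite lem_mlcm; case/andP: hi => _ ->; case/andP: hj.
have [e1 he1 E1] := term i j hi erefl hlcm.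
have [e2 he2 E2] : exists2 e, mact e (pl j) = M
    & 'X_[d] * ucoef le s f c a j i = ((c j)^-1 * cofactor_mon s a j i) *: 'X_[e].
  by apply: term => //; rewrite /d mlcmC.
have E l : ('X_[d] *: pair_vec i j) 0 l =
   ((c i)^-1 * cofactor_mon s a i j * (l == i)%:R) *: 'X_[e1]
   - ((c j)^-1 * cofactor_mon s a j i * (l == j)%:R) *: 'X_[e2].
  rewrite !mxE /= mulrBr !mulrA E1 E2.
  by do 2 case: eqP => _; rewrite ?mulr1 ?mulr0 ?scale0r.
split.
  move=> l; rewrite E; have [->|hli] := eqVneq l i.
    rewrite (negPf hij) mulr0 scale0r subr0.
    by apply/(submodZ (below_submodule _ _ _ _))/monomial_below.
  rewrite mulr0 scale0r sub0r -scaleNr.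
  have [->|hlj] := eqVneq l j.
    by apply/(submodZ (below_submodule _ _ _ _))/monomial_below.
  by rewrite mulr0 oppr0 scale0r; apply: (submod0 (below_submodule _ _ _ _)).
apply/rowP => l; rewrite mxE E pair_relationE topcoefB !topcoefZ.
have [->|hli] := eqVneq l i.
  rewrite (negPf hij) !mulr0 mul0r !subr0 (monomial_topcoef _ he1) !mulr1.
  by rewrite mulrA divrr // mul1r.
have [->|hlj] := eqVneq l j.
  rewrite !mulr0 mul0r !sub0r (monomial_topcoef _ he2) !mulr1.
  by rewrite mulrN mulrA divrr // mul1r.
by rewrite !mulr0 !mul0r subr0 mulr0.
Qed.

(** The leading terms cancel in the S-pair, so the bound given by its leading
    monomial is strict relative to the least common multiple. *)
Lemma q_strict (i j l : 'I_m) w : (i < j)%N -> (pl i).2 = (pl j).2 ->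
  (q i j l)@_w != 0 ->
  fmon_lt le (mact w (pl l)) (mlcm (pl i).1 (pl j).1, (pl i).2).
Proof.
move=> hij h2 hw; set M := (_, _).
have [|_ hbound hzero] := hq hij; first by rewrite same_componentE h2.
have hne : i != j by rewrite neq_ltn hij.
have [] := @shifted_pair_vec M _ _ hne.
- by rewrite /fmon_dvd /= eqxx lem_mlcml.
- by rewrite /fmon_dvd /= h2 eqxx lem_mlcmr.
(* For M the least common multiple itself, the shift is trivial. *)
rewrite /= (_ : _ - _ = 0)%MM; last by apply/mnmP => e; rewrite mnmBE subnn mnm0E.
rewrite mpolyX0 scale1r => hb ht.
have SE : Spair le s f c a i j = comb (pair_vec i j) f by rewrite comb_pair_vec.
have [S0|S0] := eqVneq (Spair le s f c a i j) 0.
  by rewrite hzero // mcoeff0 eqxx in hw.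
have [p hp] := LM_exists hle S0.
have [hp0 _] := LM_max hle hp.
apply: (@le_lt_trans _ _ _ hle _ p).
  by apply: hbound (hpl l) => //; rewrite mcoeff_msupp.
rewrite SE in hp0; rewrite /fmon_lt (comb_le hb hp0) andbT.
apply: contraNneq hp0 => ->.
by rewrite (comb_top hb) ht pair_relation_syz.
Qed.

(** Correcting the S-pair vector by the standard expression keeps the top
    coefficients, the correction being strictly smaller. *)
Lemma shifted_rel_vec M (i j : 'I_m) :
    (i < j)%N -> fmon_dvd (pl i) M -> fmon_dvd (pl j) M ->
  let d := (M.1 - mlcm (pl i).1 (pl j).1)%MM in
  vbelow M ('X_[d] *: rel_vec i j) /\
  top_row M ('X_[d] *: rel_vec i j) = pair_relation s a i j.
Proof.
move=> hij hi hj d.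
have h2 : (pl i).2 = (pl j).2.
  by case/andP: hi => /eqP -> _; case/andP: hj => /eqP ->.
have [|hb ht] := @shifted_pair_vec M i j _ hi hj; first by rewrite neq_ltn hij.
have [qb qt] : vbelow M ('X_[d] *: \row_l q i j l) /\
    top_row M ('X_[d] *: \row_l q i j l) = 0.
  apply/vstrictP => l w; rewrite !mxE mcoeff_mulX.
  case: ifP => [hd|]; last by rewrite eqxx.
  move/(q_strict hij h2)/(lt_mact hle d).
  rewrite -mactD addmC submK // /mact /= submK ?lem_mlcm; last first.
    by case/andP: hi => _ ->; case/andP: hj.
  by case/andP: hi => /eqP -> _; case: (M).
by rewrite scalerBr top_rowB ht qt subr0; split=> //; apply: vbelowB.
Qed.

Lemma vbelow_lin M (x : R) v w : vbelow M v -> vbelow M w ->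
  vbelow M (x%:MP *: v + w).
Proof.
move=> hv hw l; rewrite !mxE mul_mpolyC.
exact: (submod_lin (below_submodule _ _ _ _)).
Qed.

Lemma top_row_lin M (x : R) v w :
  top_row M (x%:MP *: v + w) = x *: top_row M v + top_row M w.
Proof. by apply/rowP => l; rewrite !mxE mul_mpolyC topcoef_lin mulrDr mulrCA. Qed.

Definition rel_module : 'rV[S]_m -> Prop :=
  gen (fun v => exists i j : 'I_m, [/\ (i < j)%N, (pl i).2 = (pl j).2 & v = rel_vec i j]).

Lemma rel_module_syz v : rel_module v -> comb v f = 0.
Proof.
move: v; apply: gen_min => [|v [i [j [hij h2 ->]]]]; last exact: comb_rel_vec_f.
by split=> [|x v w hv hw]; rewrite ?comb0 // comb_lin hv hw scaler0 addr0.
Qed.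

(** The top coefficients of a syzygy form a syzygy of s-monomials, supported on the
    positions whose leading monomial divides M; by monomial_syzygies it is a
    combination of pair relations, each of which lifts to a relation vector. *)
Lemma cancel_top M v : comb v f = 0 -> vbelow M v ->
  exists2 v0, rel_module v0 & vstrict M (v - v0).
Proof.
move=> hv0 hvM.
(* The rows of top coefficients that lift to the relation module. *)
pose H (t : 'rV[R]_m) := exists2 v0, rel_module v0 & vbelow M v0 /\ top_row M v0 = t.
have hH : is_submodule H.
  split.
    exists 0; first exact: (submod0 (gen_submodule _)).
    by apply/vstrictP => l w; rewrite mxE mcoeff0 eqxx.
  move=> x _ _ [v1 g1 [b1 <-]] [v2 g2 [b2 <-]].
  exists (x%:MP *: v1 + v2); first exact: (submod_lin (gen_submodule _)).
  by rewrite top_row_lin; split=> //; apply: vbelow_lin.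
have [v0 g0 [b0 t0]] : H (top_row M v).
  have : relation_span s a (fun l => fmon_dvd (pl l) M) (top_row M v).
    apply: (monomial_syzygies hs); last first.
      by rewrite -comb_top // hv0 /fcoef mxE mcoeff0.
    by move=> l /negPf hl; rewrite mxE /topcoef -/(fmon_dvd (pl l) M) hl mulr0.
  apply: (gen_min hH) => _ [i [j [hij hi hj ->]]].
  exists ('X_[M.1 - mlcm (pl i).1 (pl j).1] *: rel_vec i j); last exact: shifted_rel_vec.
  apply: (submodZ (gen_submodule _)); apply: gen_incl; exists i, j; split=> //.
  by case/andP: hi => /eqP -> _; case/andP: hj => /eqP ->.
exists v0 => //; apply/vstrictP; split; first exact: vbelowB.
by rewrite top_rowB t0 subrr.
Qed.

(** Well-founded induction on a bound M for the terms of the syzygy: cancelling the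
    terms at M leaves a syzygy whose largest term provides a smaller bound. *)
Lemma syz_rel_module v : comb v f = 0 -> rel_module v.
Proof.
have bounded M w : comb w f = 0 -> vbelow M w -> rel_module w.
  elim/(mo_ind hle): M w => M IH w hw hwM.
  have [w0 g0 hstrict] := cancel_top hw hwM.
  rewrite -[w](subrK w0); apply: (submodD (gen_submodule _)) => //.
  have [->|/vbelow_attained [l [u [hu hb]]]] := eqVneq (w - w0) 0.
    exact: (submod0 (gen_submodule _)).
  apply: (IH (mact u (pl l))) hb; first exact: hstrict.
  by rewrite combB hw (rel_module_syz g0) subrr.
move=> hv; have [->|/vbelow_attained [l [u [_ hb]]]] := eqVneq v 0.
  exact: (submod0 (gen_submodule _)).
exact: bounded hv hb.
Qed.

End Schreyer.

Theorem theorem3p7 (R : comUnitRingType) (n r : nat)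
  (le : rel (fmon n r)) (hle : monomial_order le)
  (k : nat) (s : 'I_k -> R)
  (hs : permutable_weak_regular s)
  (hsU : forall i, s i \isn't a GRing.unit)
  (m : nat) (f : 'I_m -> 'rV[{mpoly R[n]}]_r)
  (hf : forall i, smonomial_type le s (f i))
  (U : 'rV[{mpoly R[n]}]_r -> Prop) (hU : is_submodule U)
  (hG : groebner_basis le U f)
  (c : 'I_m -> R) (a : 'I_m -> 'X_{1..k})
  (hc : forall i, c i \is a GRing.unit)
  (hca : forall i, lc le (f i) = c i * smon s (a i))
  (q : 'I_m -> 'I_m -> 'I_m -> {mpoly R[n]})
  (hq : forall i j : 'I_m, (i < j)%N -> same_component le (f i) (f j) ->
          standard_expr le s f c a i j (q i j))
  (L : lmodType {mpoly R[n]}) (g : 'I_m -> L) (hg : is_basis g) :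
  forall x : L,
    gen (fun y => exists i j : 'I_m,
           [/\ (i < j)%N, same_component le (f i) (f j)
             & y = pair_syz le s f c a g i j (q i j)]) x
    <-> Syz f g x.
Proof.
have [pl hpl] : exists pl, forall i, LM le (f i) = Some (pl i).
  by apply: (fin_all_exists (P := fun i p => LM le (f i) = Some p)) => i;
    apply: LM_exists => //; case: (hf i).
move=> x; split.
  move: x; apply: gen_min => [|_ [i [j [hij hcomp ->]]]].
    split=> [|y _ _ [h [-> h0]] [h' [-> h0']]].
      exists (fun=> 0); rewrite !big1 // => i _; exact: scale0r.
    exists (fun i => y * h i + h' i); rewrite scaler_sumr -big_split /=; split.
      by apply: eq_bigr => i _; rewrite scalerDl scalerA.
    under eq_bigr do rewrite scalerDl -scalerA.
    by rewrite big_split /= -scaler_sumr h0 h0' scaler0 addr0.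
  exists (rel_vec le s f c a q i j 0); split.
    by rewrite -comb_rel_vec.
  apply: (comb_rel_vec_f hpl hq hij).
  by move: hcomp; rewrite (same_componentE hpl) => /eqP.
case=> h [-> h0].
have hE (V : lmodType {mpoly R[n]}) (y : 'I_m -> V) :
    \sum_i h i *: y i = comb (\row_l h l) y.
  by apply: eq_bigr => l _; rewrite mxE.
rewrite hE in h0; rewrite hE.
move: (syz_rel_module hle hs hpl hc hca hq h0).
set H := gen _; apply: (gen_min (H := fun v => H (comb v g))).
  split=> [|y v w hv hw]; first by rewrite comb0; apply: submod0 (gen_submodule _).
  by rewrite comb_lin; apply: (submod_lin (gen_submodule _)).
move=> _ [i [j [hij h2 ->]]]; rewrite comb_rel_vec.
by apply: gen_incl; exists i, j; rewrite (same_componentE hpl) h2.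
Qed.
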